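(* For every constant $c>0$ there are constants $C,C',\delta>0$ such that for all sufficiently large $n$ and all integers $m,k$ with $C\log n\le k\le m\le cn$, the following $n$-processor protocol takes at most $C'k$ rounds, uses at most $C'k$ private random bits per processor, and is a $(k+s,\,m,\,n,\,\lfloor\delta k\rfloor)$ $\mathsf{BCAST}(1)$ pseudo-random generator, where $s=\lceil k(m-k)/n\rceil$: - each processor gets $k+s$ private uniform random bits; - in $s$ rounds, all processors broadcast their last $s$ random bits, and the broadcast bits (the first $k(m-k)$ of them in a fixed order) are used as the entries of a uniformly random matrix $M\in\{0,1\}^{k\times(m-k)}$; - each processor outputs the concatenation $(x,x^{T}M)\in\{0,1\}^m$, where $x\in\{0,1\}^k$ is the vector of its first $k$ random bits and $x^TM$ is computed over $\mathbb{F}_2$.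
   Context: **Model.** In the $\mathsf{BCAST}(1)$ (Broadcast Congested Clique) model there are $n$ processors numbered $1,\dots,n$, each holding a private input string. Computation proceeds in synchronous rounds; in each round every processor broadcasts a single bit (the same bit to all processors), which may depend on its index, its input, its random bits and all bits broadcast in previous rounds. The transcript is the list of all broadcast bits, together with sender and round. **Pseudo-random generator.** A $(k',m,n,\ell)$ $\mathsf{BCAST}(1)$ pseudo-random generator is an $n$-processor $\mathsf{BCAST}(1)$ protocol such that: (i) at the beginning every processor gets $k'$ private, uniform and independent random bits; (ii) after the protocol each processor holds an output of $m$ bits (not broadcast); (iii) for every $\ell$-round $\mathsf{BCAST}(1)$ protocol $\Pi$ with $n$ processors, each having an $m$-bit input, the statistical distance between the distribution of the transcript of $\Pi$ when the inputs are the $n$ outputs of the generator and the distribution of the transcript of $\Pi$ when all inputs are independent and uniform in $\{0,1\}^m$ is at most $1/n$. Statistical distance is $\|\mathcal{D}_1-\mathcal{D}_2\|=\frac12\sum_x|\mathcal{D}_1(x)-\mathcal{D}_2(x)|$. *)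

(* Defs.v *)
From mathcomp Require Import all_boot all_order all_algebra.
From mathcomp Require Import reals.

Set Implicit Arguments.
Unset Strict Implicit.
Unset Printing Implicit Defensive.

Import GRing.Theory Num.Theory.
Local Open Scope ring_scope.

Definition bits (m : nat) := 'rV['F_2]_m.

(* The bits broadcast in one round, indexed by sender. *)
Definition round_bits (n : nat) := {ffun 'I_n -> 'F_2}.

(* [bcast i x r h] is the bit broadcast by processor [i] with input [x : I]
   and private random bits [r], after the rounds recorded (oldest first) in
   [h]; the current round number is [size h]. *)
Record protocol (n : nat) (I : Type) (rho : nat) := Protocol {
  rounds : nat;
  bcast : 'I_n -> I -> bits rho -> seq (round_bits n) -> 'F_2
}.

Section Run.
Variables (n : nat) (I : Type) (rho : nat) (P : protocol n I rho).
Variables (x : 'I_n -> I) (r : 'I_n -> bits rho).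

Fixpoint run (t : nat) : seq (round_bits n) :=
  if t is t'.+1 then
    let h := run t' in rcons h [ffun i => bcast P i (x i) (r i) h]
  else [::].

Lemma size_run t : size (run t) == t.
Proof. by elim: t => //= t IHt; rewrite size_rcons eqSS. Qed.

Definition transcript : (rounds P).-tuple (round_bits n) :=
  Tuple (size_run (rounds P)).

End Run.

(* The law of [X] under the uniform distribution on [Omega], as a mass
   function. *)
Definition law (R : realType) (Omega T : finType) (X : Omega -> T) (t : T) : R :=
  #|[set w | X w == t]|%:R / #|Omega|%:R.

Definition stat_dist (R : realType) (T : finType) (D1 D2 : T -> R) : R :=
  2^-1 * \sum_(t : T) `|D1 t - D2 t|.

(* The processors have no input, only [k'] private random bits; [output i] is
   computed from the private bits of [i] and the transcript. *)
Record generator (k' m n : nat) := Generator {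
  gen_protocol :> protocol n unit k';
  output :
    'I_n -> bits k' -> (rounds gen_protocol).-tuple (round_bits n) -> bits m
}.

Definition gen_outputs (k' m n : nat) (G : generator k' m n)
    (r : 'I_n -> bits k') : 'I_n -> bits m :=
  fun i => output i (r i) (transcript G (fun=> tt) r).

(* In both laws the second component of the sample holds the private random
   bits of the distinguisher [P], arbitrarily many per processor. *)
Definition is_prg (R : realType) (k' m n l : nat) (G : generator k' m n) : Prop :=
  forall (rho : nat) (P : protocol n (bits m) rho), rounds P = l ->
    stat_dist
      (law R (fun w : {ffun 'I_n -> bits k'} * {ffun 'I_n -> bits rho} =>
         transcript P (gen_outputs G w.1) w.2))
      (law R (fun w : {ffun 'I_n -> bits m} * {ffun 'I_n -> bits rho} =>
         transcript P w.1 w.2))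
    <= n%:R^-1.

Definition ceil_divn (a b : nat) : nat := ((a + b.-1) %/ b)%N.

Section MatrixGenerator.
Variables (n m k : nat) (le_km : (k <= m)%N).

Definition seed_rounds : nat := ceil_divn (k * (m - k)) n.

(* In a run [size h < seed_rounds], so the default [0] is never broadcast. *)
Definition seed_protocol : protocol n unit (k + seed_rounds) :=
  Protocol seed_rounds
    (fun _ _ (r : bits (k + seed_rounds)) (h : seq (round_bits n)) =>
       if insub (size h) is Some t then rsubmx r 0 t else 0).

(* [o] is the fixed order in which the broadcast bits, identified by round and
   sender, are read. *)
Variable o : seq ('I_seed_rounds * 'I_n).

Definition seed_matrix (t : seed_rounds.-tuple (round_bits n)) :
    'M['F_2]_(k, m - k) :=
  let b := [seq tnth t p.1 p.2 | p <- o] in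
  vec_mx (\row_(j < k * (m - k)) b`_j).

Definition matrix_generator : generator (k + seed_rounds) m n :=
  @Generator _ m _ seed_protocol
    (fun _ r t => let x := lsubmx r in
       castmx (erefl 1%N, subnKC le_km) (row_mx x (x *m seed_matrix t))).

End MatrixGenerator.

(* Main.v *)
(* Given the matrix M the inputs are independent, so a transcript t of a
   deterministic distinguisher has probability prod_i b_i, against prod_i a_i
   for uniform inputs, where a_i is the density of the set D_i(t) of inputs of
   processor i consistent with t and b_i its density along x |-> (x, x^T M).
   For any nonnegative reals,
     prod_i a_i - prod_i b_i <= sum_i (prod_(j != i) a_j) (a_i - b_i)^+.
   Distinct nonzero x have independent uniform images x^T M, so a second moment
   bound gives E_M (a_i - b_i)^+ <= eps a_i + 2^-k (1 + 1 / (4 eps)) for every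
   eps > 0.  As prod_i a_i sums to 1 over t and prod_(j != i) a_j sums to 2^l,
   the distance is at most n (eps + 2^(l-k) (1 + 1 / (4 eps))); take
   eps = 1 / (2 n^2) and l <= k / 2. *)

Require Import Defs.
From mathcomp Require Import all_boot all_order all_algebra.
From mathcomp Require Import reals sequences exp.
From mathcomp Require Import zify ring lra.

Set Implicit Arguments.
Unset Strict Implicit.
Unset Printing Implicit Defensive.

Import Order.TTheory GRing.Theory Num.Theory.
Local Open Scope ring_scope.

(** * Means, laws and statistical distance on finite sets *)

Section FiniteProbability.
Variable R : realType.

Definition mean (A : finType) (F : A -> R) : R := (\sum_a F a) / #|A|%:R.

Definition density (T : finType) (D : {set T}) : R := #|D|%:R / #|T|%:R.

Lemma density_ge0 (T : finType) (D : {set T}) : 0 <= density D.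
Proof. by rewrite divr_ge0. Qed.

Lemma sum_mem_nat (T : finType) (D : {set T}) :
  \sum_x (x \in D)%:R = #|D|%:R :> R.
Proof. by rewrite -natr_sum -sum1_card [in RHS]big_mkcond. Qed.

Lemma ler_mean (A : finType) (F G : A -> R) :
  (forall a, F a <= G a) -> mean F <= mean G.
Proof. by move=> leFG; rewrite ler_wpM2r ?invr_ge0 ?ler_sum. Qed.

Lemma mean_sum (A I : finType) (F : I -> A -> R) :
  mean (fun a : A => \sum_i F i a) = \sum_i mean (F i).
Proof. by rewrite /mean exchange_big mulr_suml. Qed.

Lemma mean_mull (A : finType) (c : R) (F : A -> R) :
  mean (fun a : A => c * F a) = c * mean F.
Proof. by rewrite /mean -mulr_sumr mulrA. Qed.

Lemma sum_law (Omega T : finType) (X : Omega -> T) :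
  (0 < #|Omega|)%N -> \sum_t law R X t = 1.
Proof.
move=> Omega_gt0; rewrite -mulr_suml; apply: canLR (mulfK _) _.
  by rewrite pnatr_eq0 -lt0n.
rewrite mul1r -natr_sum -sum1_card (partition_big X predT) //=.
by congr _%:R; apply: eq_bigr => t _; rewrite sum1dep_card.
Qed.

(** Equal total masses make the positive and negative parts of [D1 - D2] sum to the same value, so
    one-sided estimates suffice. *)
Lemma stat_dist_pos_part (T : finType) (D1 D2 : T -> R) :
  \sum_t D1 t = \sum_t D2 t ->
  stat_dist D1 D2 = \sum_t Num.max 0 (D2 t - D1 t).
Proof.
move=> eq_sum; rewrite /stat_dist.
have -> : \sum_t `|D1 t - D2 t| =
  \sum_t (2 * Num.max 0 (D2 t - D1 t) + (D1 t - D2 t)).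
  apply: eq_bigr => t _; rewrite maxEle; case: ifPn => [h|].
    by rewrite ler0_norm; last lra; ring.
  by rewrite -ltNge => h; rewrite ger0_norm; last lra; ring.
by rewrite big_split /= sumrB eq_sum subrr addr0 -mulr_sumr mulKf ?pnatr_eq0.
Qed.

Lemma law_pair (A C T : finType) (X : A * C -> T) t :
  law R X t = mean (fun z : C => law R (fun a => X (a, z)) t).
Proof.
rewrite /mean -mulr_suml -mulrA /law card_prod natrM invfM; congr (_ * _).
rewrite -natr_sum -sum1dep_card; congr _%:R.
rewrite big_mkcond /=.
rewrite (eq_bigr (fun p => if X (p.1, p.2) == t then 1 else 0)%N); last by case.
rewrite -(pair_bigA _ (fun a z => if X (a, z) == t then 1 else 0)%N) exchange_big /=.
by apply: eq_bigr => z _; rewrite -big_mkcond sum1dep_card.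
Qed.

Lemma law_bij (Omega Omega' T : finType) (f : Omega' -> Omega) (X : Omega -> T) t :
  bijective f -> law R (fun w => X (f w)) t = law R X t.
Proof.
move=> f_bij; rewrite /law (bij_eq_card f_bij) -!sum1dep_card.
by rewrite [X in _ = X%:R / _](reindex f) //; apply: onW_bij.
Qed.

Lemma eq_law (Omega T : finType) (X Y : Omega -> T) :
  X =1 Y -> law R X =1 law R Y.
Proof. by move=> XY t; rewrite /law; under eq_finset do rewrite XY. Qed.

Lemma eq_stat_dist (T : finType) (D1 D2 E1 E2 : T -> R) :
  D1 =1 E1 -> D2 =1 E2 -> stat_dist D1 D2 = stat_dist E1 E2.
Proof. by move=> e1 e2; congr (_ * _); apply: eq_bigr => t _; rewrite e1 e2. Qed.

(** Triangle inequality over the common component [z]; it serves to fix the private bits of the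
    distinguisher. *)
Lemma stat_dist_average (A B C T : finType) (X : A * C -> T) (Y : B * C -> T)
    (d : R) :
  (0 < #|C|)%N ->
  (forall z, stat_dist (law R (fun a => X (a, z))) (law R (fun b => Y (b, z)))
             <= d) ->
  stat_dist (law R X) (law R Y) <= d.
Proof.
move=> C_gt0 le_d.
have CR0 : #|C|%:R != 0 :> R by rewrite pnatr_eq0 -lt0n.
apply: (@le_trans _ _ (mean (fun _ : C => d))); last first.
  by rewrite /mean sumr_const -[d *+ _]mulr_natr mulfK.
apply: le_trans (ler_mean le_d).
rewrite /stat_dist mean_mull mean_sum ler_pM2l ?invr_gt0 ?ltr0n //.
apply: ler_sum => t _; rewrite !law_pair /mean -mulrBl -sumrB normrM.
by rewrite [`|_^-1|]ger0_norm ?invr_ge0 // ler_wpM2r ?invr_ge0 // ler_norm_sum.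
Qed.

(** With [A], [B] the products over the tail, [a x * A - b x * B] is at most [A * max(0, a x - b x)
    + min(a x, b x) * (A - B)]. So only factors [a] remain, where plain telescoping leaves mixed
    products. *)
Lemma prod_sub_le (I : eqType) (s : seq I) (a b : I -> R) :
  uniq s -> (forall i, 0 <= a i) -> (forall i, 0 <= b i) ->
  \prod_(i <- s) a i - \prod_(i <- s) b i <=
  \sum_(i <- s) (\prod_(j <- s | j != i) a j) * Num.max 0 (a i - b i).
Proof.
move=> + a_ge0 b_ge0; elim: s => [_|x s IHs /= /andP[xs /IHs {}IHs]].
  by rewrite !big_nil subrr.
rewrite !big_cons eqxx /=.
have -> : \prod_(j <- s | j != x) a j = \prod_(j <- s) a j.
  rewrite big_mkcond; apply: eq_big_seq => j js.
  by case: eqP => // jx; rewrite -jx js in xs.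
have -> : \sum_(i <- s) (\prod_(j <- x :: s | j != i) a j) * Num.max 0 (a i - b i)
   = a x * \sum_(i <- s) (\prod_(j <- s | j != i) a j) * Num.max 0 (a i - b i).
  rewrite mulr_sumr; apply: eq_big_seq => i si; rewrite big_cons.
  by case: eqP => [xi|_]; [rewrite xi si in xs | rewrite mulrA].
set U := \sum_(i <- s) _ in IHs *.
have U_ge0 : 0 <= U.
  by apply: sumr_ge0 => i _; rewrite mulr_ge0 ?prodr_ge0 // le_max lexx.
have A_ge0 : 0 <= \prod_(j <- s) a j by apply: prodr_ge0.
have B_ge0 : 0 <= \prod_(j <- s) b j by apply: prodr_ge0.
move: (a_ge0 x) (b_ge0 x) => ax bx.
by rewrite maxEle; case: ifPn => [h|]; rewrite -?ltNge; nra.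
Qed.

Lemma card_ffun_in (n : nat) (V : finType) (D : 'I_n -> {set V}) :
  #|[set w : {ffun 'I_n -> V} | [forall i, w i \in D i]]| = (\prod_i #|D i|)%N.
Proof.
have := card_family (fun i => mem (D i)).
rewrite foldrE big_map big_enum /= => <-.
by apply: eq_card => w; rewrite inE; apply/forallP/familyP.
Qed.

End FiniteProbability.

(** * Transcripts and the product structure of their input sets *)

Section Consistency.
Variables (n : nat) (I : finType) (rho : nat).
Implicit Types (P : protocol n I rho) (r : 'I_n -> bits rho).

Definition consistent P r (t : (rounds P).-tuple (round_bits n)) (i : 'I_n) :
    {set I} :=
  [set v | [forall j : 'I_(rounds P),
              bcast P i v (r i) (take j t) == tnth t j i]].

(** A bit depends only on its sender's data and the history; with the history read off [t] itself,
    the condition splits over the processors. *)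
Lemma transcript_consistent P (x : 'I_n -> I) r
    (t : (rounds P).-tuple (round_bits n)) :
  (transcript P x r == t) = [forall i, x i \in consistent r t i].
Proof.
have take_run a b : (a <= b)%N -> take a (run P x r b) = run P x r a.
  elim: b => [|b IHb]; first by rewrite leqn0 => /eqP ->.
  rewrite leq_eqVlt => /predU1P[-> | lt_ab].
    by rewrite take_oversize ?(eqP (size_run _ _ _ _)).
  by rewrite /= -cats1 takel_cat ?IHb ?(eqP (size_run _ _ _ _)).
apply/eqP/forallP => [<- i|t_cons].
  rewrite inE; apply/forallP => j.
  (* Entry [j] of the full run is the last entry of the run of [j.+1] rounds; the default is never
     reached. *)
  rewrite (tnth_nth [ffun=> 0]) /= take_run ?(ltnW (ltn_ord j)) //.
  rewrite -(nth_take _ (ltnSn j)) take_run //= nth_rcons.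
  by rewrite (eqP (size_run _ _ _ _)) ltnn eqxx ffunE.
have run_t a : (a <= rounds P)%N -> run P x r a = take a t.
  elim: a => [_|a IHa lt_a]; first by rewrite take0.
  rewrite /= IHa ?(ltnW lt_a) // (take_nth [ffun=> 0]) ?size_tuple //.
  congr rcons; apply/ffunP => i; rewrite ffunE.
  have := t_cons i; rewrite inE => /forallP/(_ (Ordinal lt_a))/eqP /= ->.
  by rewrite (tnth_nth [ffun=> 0]).
by apply: val_inj; rewrite /= run_t // take_oversize // size_tuple.
Qed.

Lemma eq_transcript P (x y : 'I_n -> I) r :
  x =1 y -> transcript P x r = transcript P y r.
Proof.
move=> xy; apply/eqP; rewrite transcript_consistent; apply/forallP => i.
have := eqxx (transcript P y r); rewrite transcript_consistent => /forallP/(_ i).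
by rewrite xy.
Qed.

Variable R : realType.

Lemma law_transcript_comp (E : finType) (g : E -> I) P r
    (t : (rounds P).-tuple (round_bits n)) :
  law R (fun x : {ffun 'I_n -> E} => transcript P (fun i => g (x i)) r) t =
  \prod_i density R [set e | g e \in consistent r t i].
Proof.
rewrite /law.
have -> : [set w : {ffun 'I_n -> E} | transcript P (fun i => g (w i)) r == t] =
    [set w : {ffun _ -> _} |
      [forall i, w i \in [set e | g e \in consistent r t i]]].
  apply/setP => w; rewrite !inE transcript_consistent.
  by apply: eq_forallb => i; rewrite inE.
by rewrite card_ffun_in card_ffun card_ord natr_prod natrX
  prodf_div prodr_const card_ord.
Qed.

Lemma law_transcript P r (t : (rounds P).-tuple (round_bits n)) :
  law R (fun x : {ffun 'I_n -> I} => transcript P x r) t =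
  \prod_i density R (consistent r t i).
Proof.
rewrite (law_transcript_comp id); apply: eq_bigr => i _; congr density.
by apply/setP => v; rewrite inE.
Qed.

Lemma sum_prod_density P r : (0 < #|I|)%N ->
  \sum_(t : (rounds P).-tuple (round_bits n))
     \prod_i density R (consistent r t i) = 1.
Proof.
move=> I_gt0; under eq_bigr do rewrite -law_transcript.
by apply: sum_law; rewrite card_ffun expn_gt0 I_gt0.
Qed.

(* Replacing the bits of [i] by a fixed string [b] gives a protocol whose
   transcript law is the product of the other densities on the transcripts
   where [i] broadcasts [b]; then sum over the [2 ^ rounds P] strings. *)
Lemma sum_prod_density_other P r (i : 'I_n) : (0 < #|I|)%N ->
  \sum_(t : (rounds P).-tuple (round_bits n))
     \prod_(j | j != i) density R (consistent r t j) = 2 ^+ rounds P.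
Proof.
move=> I_gt0.
pose mute (b : (rounds P).-tuple 'F_2) : protocol n I rho :=
  Protocol (rounds P)
    (fun j v s h => if j == i then nth 0 b (size h) else bcast P j v s h).
have sum_mute b : \sum_(t : (rounds P).-tuple (round_bits n))
    (b == [tuple tnth t j i | j < rounds P])%:R *
      \prod_(j | j != i) density R (consistent r t j) = 1.
  rewrite -[RHS](sum_prod_density (mute b) r I_gt0).
  apply: eq_bigr => t _; rewrite [RHS](bigD1 i) //=; congr (_ * _).
    have nthE (j : 'I_(rounds P)) : nth 0 b (size (take j t)) = tnth b j.
      by rewrite size_take size_tuple ltn_ord -tnth_nth.
    case: eqP => [b_t|b_t].
      suff -> : consistent (P := mute b) r t i = [set: I].
        by rewrite /density cardsT divff // pnatr_eq0 -lt0n.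
      apply/setP => v; rewrite !inE; apply/forallP => j /=.
      by rewrite eqxx nthE b_t tnth_mktuple.
    suff -> : consistent (P := mute b) r t i = set0.
      by rewrite /density cards0 mul0r.
    apply/setP => v; rewrite !inE; apply/negP => /forallP t_cons; apply: b_t.
    apply: eq_from_tnth => j; rewrite tnth_mktuple -nthE.
    by have /eqP := t_cons j; rewrite /= eqxx.
  apply: eq_bigr => j ji; congr density; apply/setP => v; rewrite !inE.
  by apply: eq_forallb => u; rewrite /= (negbTE ji).
transitivity (\sum_(b : (rounds P).-tuple 'F_2) (1 : R)).
  rewrite -[RHS](eq_bigr _ (fun b _ => sum_mute b)) exchange_big.
  apply: eq_bigr => t _; rewrite -mulr_suml.
  rewrite (bigD1 [tuple tnth t j i | j < rounds P]) //= eqxx [X in _ + X]big1.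
    by rewrite addr0 mul1r.
  by move=> b /negbTE ->.
by rewrite sumr_const card_tuple card_Fp // natrX.
Qed.

End Consistency.

(** * A second moment bound for a uniformly random matrix *)

Section RandomMatrix.
Variable R : realType.

(* The bijections [tau] shift [f] while fixing [h], so conditionally on [h]
   the value of [f] is uniform. *)
Lemma sum_mul_shift (A : finType) (B : finZmodType) (f : A -> B) (Z : B -> R)
    (h : A -> R) :
  (forall z, exists2 tau : A -> A, injective tau &
     forall a, f (tau a) = f a + z /\ h (tau a) = h a) ->
  #|B|%:R * \sum_a Z (f a) * h a = (\sum_b Z b) * \sum_a h a.
Proof.
move=> shift.
have sum_shift z : \sum_a Z (f a + z) * h a = \sum_a Z (f a) * h a.
  have [tau tau_inj tauE] := shift z.
  rewrite [RHS](reindex_inj tau_inj).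
  by apply: eq_bigr => a _; have [-> ->] := tauE a.
(* Sum over all shifts [z]: for each [a], [f a + z] runs through all of [B]. *)
rewrite mulr_natl -sumr_const.
rewrite -[LHS](eq_bigr _ (fun z _ => sum_shift z)) exchange_big mulr_sumr.
apply: eq_bigr => a _; rewrite -mulr_suml; congr (_ * _).
by rewrite [RHS](reindex_inj (addrI (f a))).
Qed.

(** Over F_2 the span of [x'] is only 0 and [x'], so it misses [x], and some functional kills [x']
    but not [x]; its nonzero value at [x] must be 1. *)
Lemma separating_col k (x x' : 'rV['F_2]_k) :
  x != 0 -> x != x' -> exists2 u : 'cV_k, x *m u = 1%:M & x' *m u = 0.
Proof.
move=> x0 xx'.
have : ~~ (x <= x')%MS.
  apply/negP => /sub_rVP[a xE]; move: x0 xx'; rewrite xE.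
  have : a \in [:: 0; 1] by case: a {xE} => [[|[|]]].
  by rewrite !inE => /pred2P[]->; rewrite ?scale0r ?scale1r eqxx.
rewrite submxE => /rV0Pn[j xj].
exists (col j (cokermx x')); rewrite colE mulmxA ?mulmx_coker ?mul0mx //.
rewrite -colE; apply/rowP => l; rewrite !mxE !ord1 eqxx /=.
move: xj; rewrite mxE; set e := \sum_i _.
by case: e => [[|[|]]] // *; apply: val_inj.
Qed.

Variables (k q : nat) (A : finType) (M : A -> 'M['F_2]_(k, q)).
Hypothesis A_gt0 : (0 < #|A|)%N.
(** Uniformity of [M a], in a form that a seed longer than the matrix satisfies directly. *)
Hypothesis M_shift : forall N, exists2 tau : A -> A, injective tau &
  forall a, M (tau a) = M a + N.

(** Adding [u *m z] to [M a] moves [x *m M a] by [z] and fixes [x' *m M a]: given the latter, the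
    former is uniform. *)
Lemma sum_row_pair (x x' : 'rV['F_2]_k) (Z h : 'rV['F_2]_q -> R) :
  x != 0 -> x != x' ->
  #|{: 'rV['F_2]_q}|%:R * \sum_a Z (x *m M a) * h (x' *m M a) =
  (\sum_y Z y) * \sum_a h (x' *m M a).
Proof.
move=> x0 xx'; apply: sum_mul_shift => z.
have [u xu x'u] := separating_col x0 xx'.
have [tau tau_inj tauE] := M_shift (u *m z); exists tau => // a.
by rewrite tauE !mulmxDr !mulmxA xu x'u mul1mx mul0mx addr0.
Qed.

Section OneSet.
Variable D : {set 'rV['F_2]_(k + q)}.

Let K : R := #|{: 'rV['F_2]_k}|%:R.
Let Q : R := #|{: 'rV['F_2]_q}|%:R.
Let p (x : 'rV['F_2]_k) : R := #|[set y | row_mx x y \in D]|%:R / Q.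
(** The centred indicator of the fibre of [D] over [x], with the sign that makes missing mass
    positive. *)
Let Z x y : R := p x - (row_mx x y \in D)%:R.

Let Q_gt0 : 0 < Q.
Proof. by rewrite ltr0n; apply/card_gt0P; exists 0. Qed.

Let K_gt0 : 0 < K.
Proof. by rewrite ltr0n; apply/card_gt0P; exists 0. Qed.

Let sum_fiber x : \sum_y (row_mx x y \in D)%:R = Q * p x.
Proof.
rewrite mulrC mulfVK ?gt_eqF // -sum_mem_nat.
by apply: eq_bigr => y _; rewrite inE.
Qed.

Let p_ge0 x : 0 <= p x.
Proof. by rewrite divr_ge0 // ltW. Qed.

Let sum_Z x : \sum_y Z x y = 0.
Proof. by rewrite sumrB sum_fiber sumr_const -[_ *+ _]mulr_natl subrr. Qed.

Let sum_p : \sum_x p x = K * density R D.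
Proof.
apply: (mulfI (lt0r_neq0 Q_gt0)); rewrite mulr_sumr.
rewrite (eq_bigr _ (fun x _ => esym (sum_fiber x))) pair_big /=.
pose split_row (v : 'rV['F_2]_(k + q)) := (lsubmx v, rsubmx v).
rewrite (reindex split_row) /=; last first.
  apply: onW_bij; exists (fun y => row_mx y.1 y.2) => [v|[y z]].
    exact: hsubmxK.
  by rewrite /split_row row_mxKl row_mxKr.
rewrite (eq_bigr (fun v => (v \in D)%:R)) => [|v _]; last by rewrite hsubmxK.
rewrite sum_mem_nat /density mulrA [Q * K]mulrC -natrM.
have -> : (#|{: 'rV['F_2]_k}| * #|{: 'rV['F_2]_q}| = #|{: 'rV['F_2]_(k + q)}|)%N.
  by rewrite !card_mx !mul1n expnD.
by rewrite mulrC mulfVK // pnatr_eq0 -lt0n; apply/card_gt0P; exists 0.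
Qed.

Let A_neq0 : #|A|%:R != 0 :> R.
Proof. by rewrite pnatr_eq0 -lt0n. Qed.

(** Given the image of [x'], that of [x] is uniform, and [Z x] has mean zero. *)
Let sum_Z_cross x x' : x != 0 -> x != x' ->
  \sum_a Z x (x *m M a) * Z x' (x' *m M a) = 0.
Proof.
move=> x0 xx'; apply: (mulfI (lt0r_neq0 Q_gt0)).
by rewrite (sum_row_pair (Z x) (Z x')) // sum_Z mul0r mulr0.
Qed.

(** The variance [p x * (1 - p x)] of an indicator is at most [p x]. *)
Let sum_Z_sqr x : x != 0 -> \sum_a Z x (x *m M a) ^+ 2 <= #|A|%:R * p x.
Proof.
move=> x0.
have sum_mem : \sum_a (row_mx x (x *m M a) \in D)%:R = #|A|%:R * p x :> R.
  apply: (mulfI (lt0r_neq0 Q_gt0)).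
  (* Here [x' = 0] and [h] is constant, which gives the law of a single image; [x0] proves both side
     conditions. *)
  have := sum_row_pair (fun y => (row_mx x y \in D)%:R) (fun=> 1) x0 x0.
  under eq_bigr do rewrite mulr1.
  by rewrite sumr_const sum_fiber => ->; ring.
have -> : \sum_a Z x (x *m M a) ^+ 2 =
    \sum_a ((p x) ^+ 2 + (1 - 2 * p x) * (row_mx x (x *m M a) \in D)%:R).
  by apply: eq_bigr => a _; rewrite /Z; case: (_ \in D) => /=; ring.
rewrite big_split /= sumr_const -mulr_sumr sum_mem -[_ *+ _]mulr_natl.
rewrite -subr_ge0.
have -> : #|A|%:R * p x -
    (#|A|%:R * p x ^+ 2 + (1 - 2 * p x) * (#|A|%:R * p x)) =
  #|A|%:R * p x ^+ 2 by ring.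
by rewrite mulr_ge0 ?sqr_ge0.
Qed.

Let S a : R := \sum_(x | x != 0) Z x (x *m M a).

(** The terms of [S] are pairwise uncorrelated, so their variances add up. *)
Let sum_S_sqr : \sum_a S a ^+ 2 <= #|A|%:R * (K * density R D).
Proof.
rewrite -sum_p.
have -> : \sum_a S a ^+ 2 = \sum_(x | x != 0) \sum_(x' | x' != 0)
    \sum_a Z x (x *m M a) * Z x' (x' *m M a).
  rewrite exchange_big; under [RHS]eq_bigr do rewrite exchange_big.
  rewrite exchange_big; apply: eq_bigr => a _.
  by rewrite exchange_big expr2 big_distrlr.
apply: (@le_trans _ _ (\sum_(x | x != 0) #|A|%:R * p x)).
  apply: ler_sum => x x0; rewrite (bigD1 x) //= [X in _ + X]big1.
    by rewrite addr0; under eq_bigr do rewrite -expr2; exact: sum_Z_sqr.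
  by move=> x' /andP[_ x'x]; apply: sum_Z_cross; rewrite // eq_sym.
by rewrite -mulr_sumr ler_wpM2l // big_mkcond ler_sum // => x _; case: ifP.
Qed.

(* The row [x = 0] is mapped to [0] by every [M a]: it adds at most [1 / K] to
   the deficit, but there is no such bound on the excess, hence the one-sided
   estimate. *)
Lemma mean_density_deficit (eps : R) : 0 < eps ->
  mean (fun a => Num.max 0
    (density R D - density R [set x | row_mx x (x *m M a) \in D])) <=
  eps * density R D + (1 + (4 * eps)^-1) / K.
Proof.
move=> eps_gt0; set d := density R D.
have d_ge0 : 0 <= d by apply: density_ge0.
have c_gt0 : 0 < (4 * eps)^-1 by rewrite invr_gt0 mulr_gt0.
(* The main estimate divides by [K * d]; for [d = 0] there is no deficit. *)
have [d0|d_neq0] := eqVneq d 0.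
  rewrite (le_trans (@ler_mean _ _ _ (fun=> 0) _)) //.
    by move=> a; rewrite d0 ge_max lexx sub0r oppr_le0 density_ge0.
  by rewrite /mean big1 // mul0r d0 mulr0 add0r divr_ge0 ?addr_ge0 // ltW.
have d_gt0 : 0 < d by rewrite lt_def d_neq0.
have devE a : d - density R [set x | row_mx x (x *m M a) \in D] =
    (Z 0 (0 *m M a) + S a) / K.
  have -> : Z 0 (0 *m M a) + S a = \sum_x Z x (x *m M a) by rewrite [RHS](bigD1 0).
  rewrite /Z sumrB sum_p mulrBl mulrAC mulfV ?gt_eqF // mul1r.
  by congr (_ - _ / _); rewrite -sum_mem_nat; apply: eq_bigr => x _; rewrite inE.
have Z0_le a : Z 0 (0 *m M a) <= 1.
  rewrite /Z lerBlDr (@le_trans _ _ 1) ?lerDl // /p ler_pdivrMr // mul1r.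
  by rewrite ler_nat max_card.
set c := (4 * eps)^-1 in c_gt0 *.
have Kd_gt0 : 0 < K * d by rewrite mulr_gt0.
have amgm a : Num.max 0 (d - density R [set x | row_mx x (x *m M a) \in D]) <=
    (1 + eps * (K * d)) / K + c / (K * (K * d)) * S a ^+ 2.
  have -> : (1 + eps * (K * d)) / K + c / (K * (K * d)) * S a ^+ 2 =
      (1 + (eps * (K * d) + c / (K * d) * S a ^+ 2)) / K.
    by field; rewrite !gt_eqF.
  (* AM-GM: the gap is a square vanishing at [S a = 2 * eps * (K * d)], whence the constant
     [4 * eps]. On average the quadratic term then adds at most [c / K]. *)
  have le_S : S a <= eps * (K * d) + c / (K * d) * S a ^+ 2.
    have -> : eps * (K * d) + c / (K * d) * S a ^+ 2 = S a +
        c / (K * d) * (S a - 2 * eps * (K * d)) ^+ 2.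
      by rewrite /c; field; rewrite !gt_eqF.
    by rewrite lerDl mulr_ge0 ?sqr_ge0 // divr_ge0 // ltW.
  rewrite ge_max devE; apply/andP; split.
    apply: divr_ge0; last exact: ltW.
    rewrite addr_ge0 // addr_ge0 // mulr_ge0 ?sqr_ge0 //; first exact: ltW.
      exact: ltW.
    by rewrite divr_ge0 // ltW.
  by rewrite ler_pM2r ?invr_gt0 // lerD.
apply: (le_trans (ler_mean amgm)).
rewrite /mean big_split /= sumr_const -[_ *+ _]mulr_natl -mulr_sumr.
rewrite mulrDl [_ * _ / #|A|%:R]mulrAC mulfV // mul1r.
have cKd : 0 <= c / (K * (K * d)) by rewrite divr_ge0 ?ltW // mulr_gt0.
have -> : eps * d + (1 + c) / K =
    (1 + eps * (K * d)) / K + c / (K * (K * d)) * (K * d).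
  by field; rewrite !gt_eqF.
rewrite lerD2l -mulrA ler_wpM2l // ler_pdivrMr ?ltr0n // mulrC.
exact: sum_S_sqr.
Qed.

End OneSet.

(** The output width [m] equals [k + q] only propositionally; stated for a variable [m], the
    equality can be eliminated. *)
Lemma mean_density_deficit_cast (m : nat) (e : (k + q)%N = m)
    (D : {set 'rV['F_2]_m}) (eps : R) : 0 < eps ->
  mean (fun a => Num.max 0 (density R D -
    density R [set x | castmx (erefl 1%N, e) (row_mx x (x *m M a)) \in D])) <=
  eps * density R D + (1 + (4 * eps)^-1) / #|{: 'rV['F_2]_k}|%:R.
Proof. by case: m / e D => D; exact: mean_density_deficit. Qed.

End RandomMatrix.

(** [A] is the seed shared by all processors. For each fixed seed the inputs are independent, so a
    bound on the deficit of one set at a time is enough. *)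
Lemma stat_dist_transcript (R : realType) (n : nat) (I E A : finType)
    (rho : nat) (P : protocol n I rho) (r : 'I_n -> bits rho)
    (g : A -> E -> I) (eps eta : R) :
  (0 < #|I|)%N -> (0 < #|E|)%N -> (0 < #|A|)%N ->
  (forall D : {set I},
    mean (fun a => Num.max 0 (density R D - density R [set e | g a e \in D]))
    <= eps * density R D + eta) ->
  stat_dist
    (law R (fun w : {ffun 'I_n -> E} * A =>
              transcript P (fun i => g w.2 (w.1 i)) r))
    (law R (fun x : {ffun 'I_n -> I} => transcript P x r))
  <= n%:R * (eps + 2 ^+ rounds P * eta).
Proof.
move=> I_gt0 E_gt0 A_gt0 deficit.
rewrite stat_dist_pos_part; last first.
  by rewrite !sum_law ?card_prod ?muln_gt0 ?card_ffun ?expn_gt0 ?I_gt0 ?E_gt0.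
have A_neq0 : #|A|%:R != 0 :> R by rewrite pnatr_eq0 -lt0n.
pose a t i := density R (consistent (P := P) r t i).
pose b z t i := density R [set e | g z e \in consistent (P := P) r t i].
apply: (@le_trans _ _ (\sum_t \sum_i
    (\prod_(j | j != i) a t j) * (eps * a t i + eta))).
  apply: ler_sum => t _; rewrite law_pair law_transcript.
  have -> : mean (fun z => law R (fun w : {ffun 'I_n -> E} =>
      transcript P (fun i => g z (w i)) r) t) = mean (fun z => \prod_i b z t i).
    by congr (_ / _); apply: eq_bigr => z _; rewrite law_transcript_comp.
  apply: (@le_trans _ _ (mean (fun z => \sum_i
      (\prod_(j | j != i) a t j) * Num.max 0 (a t i - b z t i)))).
    rewrite ge_max; apply/andP; split.
      rewrite divr_ge0 // !sumr_ge0 // => z _; rewrite sumr_ge0 // => i _.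
      by rewrite mulr_ge0 ?prodr_ge0 ?le_max ?lexx // => j _; apply: density_ge0.
    have -> : \prod_i density R (consistent r t i) -
        mean (fun z => \prod_i b z t i) =
        mean (fun z => \prod_i a t i - \prod_i b z t i).
      by rewrite /mean sumrB mulrBl sumr_const -[(\prod_i _) *+ _]mulr_natr mulfK.
    apply: ler_mean => z; apply: prod_sub_le => [|i|i].
    - exact: index_enum_uniq.
    - exact: density_ge0.
    - exact: density_ge0.
  rewrite mean_sum; apply: ler_sum => i _; rewrite mean_mull ler_wpM2l //.
    by apply: prodr_ge0 => j _; apply: density_ge0.
  exact: deficit.
rewrite exchange_big /= mulr_natl -[X in _ *+ X]card_ord -sumr_const.
(* The [eps] term restores the missing factor [a t i], with total mass 1; the [eta] term lacks it,
   with total mass [2 ^+ rounds P]. *)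
apply: ler_sum => i _; under eq_bigr do rewrite mulrDr mulrCA [_ * a _ i]mulrC.
rewrite big_split /= -mulr_sumr -mulr_suml sum_prod_density_other //.
rewrite lerD2r.
have -> : \sum_t a t i * \prod_(j | j != i) a t j = 1.
  rewrite -[RHS](sum_prod_density R P r I_gt0).
  by apply: eq_bigr => t _; rewrite [RHS](bigD1 i).
by rewrite mulr1.
Qed.

(** * From seed bits to the random matrix and the generator *)

Section Seed.
Variables (n m k : nat) (le_km : (k <= m)%N).
Local Notation s := (seed_rounds n m k).
Variable o : seq ('I_s * 'I_n).
Hypothesis o_perm : perm_eq o (enum {: 'I_s * 'I_n}).

(** The matrix read from the seeds without a run, hence a random variable independent of the vectors
    [x]. *)
Definition matrix_of_seed (z : {ffun 'I_n -> bits s}) : 'M['F_2]_(k, m - k) :=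
  vec_mx (\row_(j < k * (m - k)) [seq z p.2 0 p.1 | p <- o]`_j).

(** The run is consistent with its own transcript, so its bit [(t, i)] is seed bit [t] of processor
    [i]. *)
Lemma seed_matrixE (w : 'I_n -> bits (k + s)) :
  seed_matrix o (transcript (seed_protocol n m k) (fun=> tt) w) =
  matrix_of_seed [ffun i => rsubmx (w i)].
Proof.
congr vec_mx; apply/rowP => j; rewrite !mxE; congr nth; apply: eq_map => -[t i] /=.
have := eqxx (transcript (seed_protocol n m k) (fun=> tt) w).
rewrite transcript_consistent => /forallP/(_ i); rewrite inE => /forallP/(_ t).
rewrite ffunE => /eqP <- /=.
by rewrite size_take (eqP (size_run _ _ _ _)) ltn_ord valK.
Qed.

(** The ceiling gives [s * n >= k * (m - k)], so no matrix entry is a default of [nth]. *)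
Lemma size_order : (0 < n)%N -> (k * (m - k) <= size o)%N.
Proof.
move=> n_gt0; rewrite (perm_size o_perm) -cardE card_prod !card_ord.
have := ltn_ceil (k * (m - k) + n.-1) n_gt0.
rewrite -/(ceil_divn (k * (m - k)) n) -/s mulSn; lia.
Qed.

Lemma matrix_of_seed_shift (N : 'M['F_2]_(k, m - k)) : (0 < n)%N ->
  exists2 tau, injective tau &
    forall z, matrix_of_seed (tau z) = matrix_of_seed z + N.
Proof.
move=> n_gt0.
(* [z0] holds entry [j] of [N] where [o] reads its [j]-th bit, and 0 beyond the matrix; [o] has no
   repetitions, so nothing collides. *)
pose z0 : {ffun 'I_n -> bits s} :=
  [ffun i => \row_t (if insub (index (t, i) o) is Some j then mxvec N 0 j else 0)].
exists (fun z => [ffun i => z i + z0 i]) => [z1 z2 /ffunP eq_z|z].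
  by apply/ffunP => i; have := eq_z i; rewrite !ffunE => /addIr.
rewrite -[N in RHS]mxvecK -raddfD; congr vec_mx; apply/rowP => j; rewrite !mxE.
have lt_j : (j < size o)%N by apply: leq_trans (size_order n_gt0).
have [t0 i0] : 'I_s * 'I_n by case: (o) lt_j.
rewrite !(nth_map (t0, i0)) // ffunE mxE; congr (_ + _).
rewrite ffunE mxE -surjective_pairing index_uniq // ?valK //.
by rewrite (perm_uniq o_perm) enum_uniq.
Qed.

Variable R : realType.

(** Fix the distinguisher's bits [r], then split the private bits into vectors and seeds; the seeds
    become the shared component. *)
Lemma matrix_generator_stat_dist (rho : nat) (P : protocol n (bits m) rho)
    (eps : R) : (0 < n)%N -> 0 < eps ->
  stat_dist
    (law R (fun w : {ffun 'I_n -> bits (k + s)} * {ffun 'I_n -> bits rho} =>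
       transcript P (gen_outputs (matrix_generator le_km o) w.1) w.2))
    (law R (fun w : {ffun 'I_n -> bits m} * {ffun 'I_n -> bits rho} =>
       transcript P w.1 w.2))
  <= n%:R * (eps + 2 ^+ rounds P * ((1 + (4 * eps)^-1) / 2 ^+ k)).
Proof.
move=> n_gt0 eps_gt0.
have card_bits_gt0 l : (0 < #|{: bits l}|)%N by apply/card_gt0P; exists 0.
apply: stat_dist_average => [|r]; first by rewrite card_ffun expn_gt0 card_bits_gt0.
pose g (z : {ffun 'I_n -> bits s}) (x : bits k) : bits m :=
  castmx (erefl 1%N, subnKC le_km) (row_mx x (x *m matrix_of_seed z)).
pose split_bits (w : {ffun 'I_n -> bits (k + s)}) :
    {ffun 'I_n -> bits k} * {ffun 'I_n -> bits s} :=
  ([ffun i => lsubmx (w i)], [ffun i => rsubmx (w i)]).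
have split_bij : bijective split_bits.
  exists (fun y : {ffun 'I_n -> bits k} * {ffun 'I_n -> bits s} =>
    [ffun i => row_mx (y.1 i) (y.2 i)]) => [w|[y1 y2]].
    by apply/ffunP => i; rewrite !ffunE hsubmxK.
  by congr pair; apply/ffunP => i; rewrite !ffunE ?row_mxKl ?row_mxKr.
rewrite (@eq_stat_dist _ _ _ _ (law R (fun w : {ffun 'I_n -> bits k} * _ =>
    transcript P (fun i => g w.2 (w.1 i)) r))
  (law R (fun x : {ffun 'I_n -> bits m} => transcript P x r))) //; last first.
  move=> t; rewrite -(law_bij _ _ _ split_bij); apply: eq_law => w.
  apply: eq_transcript => i; rewrite /gen_outputs /= seed_matrixE.
  by rewrite /g ffunE.
apply: stat_dist_transcript => // [|D].
  by rewrite card_ffun expn_gt0 card_bits_gt0.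
have -> : 2 ^+ k = #|{: bits k}|%:R :> R by rewrite card_mx card_Fp // mul1n natrX.
apply: mean_density_deficit_cast => // [|N].
  by rewrite card_ffun expn_gt0 card_bits_gt0.
exact: matrix_of_seed_shift.
Qed.

End Seed.

(** * Numerical estimates and choice of constants *)

Lemma expn_le_exp2 (R : realType) (n k : nat) :
  (0 < n)%N -> 20 * ln n%:R <= k%:R :> R -> (n ^ 10 <= 2 ^ k)%N.
Proof.
move=> n_gt0 le_k.
have n_pos : 0 < n%:R :> R by rewrite ltr0n.
(* From [expR (- 1/2) >= 1 - 1/2]; this turns the factor 20 into the exponent 10. *)
have ln2 : 2^-1 <= ln (2 : R).
  have : expR (- 2^-1) >= 2^-1 :> R by have := @expR_ge1Dx R (- 2^-1); lra.
  rewrite expRN lef_pV2 ?posrE ?expR_gt0 // => le_2.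
  by rewrite -[leLHS]expRK ler_ln ?posrE ?expR_gt0.
rewrite -(ler_nat R) !natrX -ler_ln ?posrE ?exprn_gt0 // !lnXn //.
rewrite -[ln n%:R *+ _]mulr_natl -[ln 2 *+ _]mulr_natl.
by have := ler_wpM2l (ler0n R k) ln2; lra.
Qed.

Theorem theorem1p3 (R : realType) (c : R) (c_gt0 : 0 < c) :
  exists C C' delta : R, [/\ 0 < C, 0 < C', 0 < delta &
    exists n0 : nat, forall n : nat, (n0 <= n)%N ->
    forall (m k : nat) (le_km : (k <= m)%N),
      C * ln n%:R <= k%:R -> m%:R <= c * n%:R ->
    let s := ceil_divn (k * (m - k)) n in
    forall o : seq ('I_s * 'I_n), perm_eq o (enum {: 'I_s * 'I_n}) ->
    let G : generator (k + s) m n := matrix_generator le_km o in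
    [/\ (rounds G)%:R <= C' * k%:R,
        (k + s)%:R <= C' * k%:R &
        is_prg R (Num.truncn (delta * k%:R)) G]].
Proof.
(* [20] gives [n ^ 10 <= 2 ^ k], [c + 2] covers [k + s] as [s <= (c + 1) * k], and [2^-1] leaves
   [2 ^ (k - l) >= n ^ 5]. *)
exists 20, (c + 2), 2^-1; split; [by []|lra|by rewrite invr_gt0|].
exists 16%N => n n_ge16 m k le_km le_k le_m s o o_perm G.
have n_gt0 : (0 < n)%N by lia.
have n_pos : 0 < n%:R :> R by rewrite ltr0n.
have n10_le : (n ^ 10 <= 2 ^ k)%N by apply: (@expn_le_exp2 R).
have k_gt0 : (0 < k)%N.
  case: k n10_le {le_km le_k s o o_perm G} => // n10_le.
  have : (16 ^ 10 <= n ^ 10)%N by rewrite leq_exp2r.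
  by move=> /leq_trans /(_ n10_le).
have s_le : s%:R <= (c + 1) * k%:R.
  (* Rounding up costs the extra [n], absorbed later through [k >= 1]. *)
  have sn_le : (s * n <= k * m + n)%N.
    have := leq_divM (k * (m - k) + n.-1) n.
    have : (k * (m - k) <= k * m)%N by rewrite leq_mul2l leq_subr orbT.
    rewrite -/(ceil_divn (k * (m - k)) n) -/s; lia.
  rewrite -(ler_pM2r n_pos) -natrM.
  apply: (@le_trans _ _ (k * m + n)%:R); first by rewrite ler_nat.
  rewrite natrD natrM.
  have k_ge1 : 1 <= k%:R :> R by rewrite ler1n.
  have := ler_wpM2l (ler0n R k) le_m; have := ler_wpM2r (ltW n_pos) k_ge1; lra.
split=> [||rho P roundsP].
- by apply: le_trans s_le _; rewrite ler_wpM2r //; lra.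
- by rewrite natrD; have := s_le; lra.
set l := Num.truncn _ in roundsP.
have l_le : (l + l <= k)%N.
  have : l%:R <= 2^-1 * k%:R :> R by rewrite truncn_le mulr_ge0 ?invr_ge0.
  by rewrite -(ler_nat R) natrD; lra.
(* Compare squares, as [2 * (k - l) >= k]. *)
have n5_le : (n ^ 5 <= 2 ^ (k - l))%N.
  rewrite -(@leq_exp2r _ _ 2) // -!expnM; apply: leq_trans n10_le _.
  by rewrite leq_exp2l //; lia.
(* With this [eps] the first error term [n * eps] is [1 / (2 * n)], half of the allowance. *)
have eps_gt0 : 0 < (2 * n%:R ^+ 2)^-1 :> R by rewrite invr_gt0 mulr_gt0 ?exprn_gt0.
apply: le_trans (matrix_generator_stat_dist le_km o_perm P n_gt0 eps_gt0) _.
rewrite roundsP.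
have -> : 2 ^+ k = 2 ^+ l * 2 ^+ (k - l) :> R.
  by rewrite -exprD subnKC //; lia.
move: n5_le; rewrite -(ler_nat R) !natrX.
have n_ge : 16 <= n%:R :> R by rewrite (ler_nat R 16).
move: (2 ^+ l) (2 ^+ (k - l)) (exprn_gt0 l (ltr0Sn R 1))
  (exprn_gt0 (k - l) (ltr0Sn R 1)).
move: (n%:R) n_ge n_pos => N N_ge N_pos L W L_gt0 W_gt0 le_W.
have -> : N * ((2 * N ^+ 2)^-1 + L * ((1 + (4 * (2 * N ^+ 2)^-1)^-1) / (L * W)))
   = N^-1 / 2 + (N + N ^+ 3 / 2) / W.
  by field; rewrite !gt_eqF.
(* The other half: as [W >= N ^ 5], it reduces to [N ^ 4 + 2 * N ^ 2 <= N ^ 5]. *)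
suff : (N + N ^+ 3 / 2) / W <= N^-1 / 2 by lra.
rewrite ler_pdivrMr //.
have -> : N^-1 / 2 * W = W / (2 * N) by field; rewrite gt_eqF.
rewrite ler_pdivlMr ?mulr_gt0 //.
apply: le_trans le_W; rewrite -subr_ge0.
have -> : N ^+ 5 - (N + N ^+ 3 / 2) * (2 * N) =
    N ^+ 4 * (N - 16) + N ^+ 2 * (15 * (N ^+ 2 - 1) + 13) by field.
by rewrite addr_ge0 ?mulr_ge0 ?exprn_ge0 //; nra.
Qed.
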